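(* Let $a<b$ be real numbers, $I=[a,b]$, let $h:J\to\mathbb{R}$ be a nonnegative supermultiplicative function with $[0,1]\subseteq J\subseteq\mathbb{R}$, and let $f,g\in SX(h,I)$ be symmetric about $\frac{a+b}{2}$. Assume the integrals below exist. Then $$\frac{1}{b-a}\int_a^b f(x)g(x)\,dx\le\frac{M(a,b)+N(a,b)}{4}\left[\int_0^1 h(\alpha^2)\,d\alpha+2\int_0^1 h(\alpha(1-\alpha))\,d\alpha+\int_0^1 h((1-\alpha)^2)\,d\alpha\right].$$
   Context: $SX(h,I)$ denotes the class of $h$-convex functions: $f:I\to\mathbb{R}$ belongs to $SX(h,I)$ if $f$ is nonnegative and $f(tx+(1-t)y)\le h(t)f(x)+h(1-t)f(y)$ for all $x,y\in I$ and $t\in[0,1]$. The function $h:J\to\mathbb{R}$ is supermultiplicative if $h(xy)\ge h(x)h(y)$ for all $x,y\in J$ (with $xy\in J$). A function $f$ on $[a,b]$ is symmetric about $\frac{a+b}{2}$ if $f(a+b-x)=f(x)$ for all $x\in[a,b]$. Notation: $M(a,b)=f(a)g(a)+f(b)g(b)$ and $N(a,b)=f(a)g(b)+f(b)g(a)$. *)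

(* Defs.v *)
From HB Require Import structures.
From mathcomp Require Export all_boot all_order all_algebra.
From mathcomp Require Export all_classical all_reals all_analysis.

Set Implicit Arguments.
Unset Strict Implicit.
Unset Printing Implicit Defensive.

Import Order.TTheory GRing.Theory Num.Theory.
Import numFieldNormedType.Exports.

Local Open Scope classical_set_scope.
Local Open Scope ring_scope.

(* Functions on a subset D of R are total functions R -> R of which only the
   values on D are ever constrained. *)

Definition nonneg_on (R : realType) (D : set R) (u : R -> R) : Prop :=
  forall x, D x -> 0 <= u x.

Definition h_convex (R : realType) (h : R -> R) (I : set R) : set (R -> R) :=
  [set f | nonneg_on I f /\
     forall x y t, I x -> I y -> 0 <= t <= 1 ->
       f (t * x + (1 - t) * y) <= h t * f x + h (1 - t) * f y].

Definition supermultiplicative (R : realType) (J : set R) (h : R -> R) : Prop :=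
  forall x y, J x -> J y -> J (x * y) -> h x * h y <= h (x * y).

Definition symmetric_about_midpoint (R : realType) (a b : R) (f : R -> R) :
    Prop :=
  forall x, `[a, b]%classic x -> f (a + b - x) = f x.

Definition M_sum (R : realType) (f g : R -> R) (a b : R) : R :=
  f a * g a + f b * g b.

Definition N_sum (R : realType) (f g : R -> R) (a b : R) : R :=
  f a * g b + f b * g a.

(* The completed Lebesgue measure is used, rather than its restriction
   lebesgue_measure to the Borel sets, so that integrands need only be Lebesgue
   measurable; in particular every Riemann integrable function on [a, b] is
   integrable in this sense. *)
Definition integrable_itv (R : realType) (a b : R) (u : R -> R) : Prop :=
  (@completed_lebesgue_measure R).-integrable `[a, b] (fun x => (u x)%:E).

Definition integral_itv (R : realType) (a b : R) (u : R -> R) : R :=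
  \int[@completed_lebesgue_measure R]_(x in `[a, b]) u x.

(* Main.v *)
Require Import Defs.
From mathcomp Require Import lra ring measurable_realfun.

Set Implicit Arguments.
Unset Strict Implicit.
Unset Printing Implicit Defensive.

(** Symmetry makes the endpoint values agree, [f a = f b] and [g a = g b], so
    the coefficient [(M + N) / 4] is [f a * g a].  Writing a point
    of [[a, b]] as [(b - a) * t + a = t * b + (1 - t) * a], h-convexity
    bounds [f] there by [(h t + h (1 - t)) * f a] and [g] by
    [(h t + h (1 - t)) * g a] ([h_convex_le_endpoint]).  In the product, the
    square [(h t + h (1 - t)) ^+ 2] expands into three products of values of
    [h], each of which supermultiplicativity moves inside [h]
    ([supermultiplicative_sqr_sum_le]).  Integrating over [t] in [[0, 1]] gives
    the right-hand side, and the substitution [x = (b - a) * t + a] identifies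
    the left-hand side with the integral of [f * g] along the parametrisation.

    The function [f * g] is only Lebesgue integrable, so this substitution needs
    the affine change of variables for the completed Lebesgue measure
    ([integral_itv_affine]).  That measure is the restriction of an outer measure
    to its Caratheodory measurable sets, and the outer measure of a set is an
    infimum over countable covers by intervals [`]x, y]].  An increasing affine
    map pulls such covers back to such covers and divides every length by its
    slope; hence it scales the outer measure of every set
    ([outer_preimage_affine]).  As Caratheodory measurability is expressed by the
    outer measure alone, the map is measurable as well ([measurable_affine]), and
    the completed measure is the slope times its own image under the map. *)

Import Order.TTheory GRing.Theory Num.Theory.
Import numFieldNormedType.Exports.
Local Open Scope classical_set_scope.
Local Open Scope ring_scope.

Section AffineInvariance.
Variable R : realType.
Implicit Types (c d x y : R) (A : set R).

(* As a function on all sets, this is the outer Lebesgue measure. *)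
Notation leb := (@completed_lebesgue_measure R).
(* The real line with the sigma-algebra of Lebesgue measurable sets. *)
Notation caraR := (caratheodory_type ((wlength (@idfun R))^*)%mu).

Definition affine c d (t : R) : R := c * t + d.

Lemma affineK c d : c != 0 ->
  cancel (affine c^-1 (- (c^-1 * d))) (affine c d).
Proof. by move=> c0 x; rewrite /affine; field. Qed.

Lemma preimage_affine_itv c d (bx bY : bool) x y : 0 < c ->
  affine c d @^-1` [set` Interval (BSide bx x) (BSide bY y)] =
  [set` Interval (BSide bx ((x - d) / c)) (BSide bY ((y - d) / c))].
Proof.
move=> c0; apply/seteqP; split=> t; rewrite /affine /= !itv_boundlr /=;
  case: bx; case: bY;
  by rewrite /<=%O/= ?ler_pdivrMr// ?ler_pdivlMr// ?ltr_pdivrMr// ?ltr_pdivlMr//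
             ?lerBlDr ?lerBrDr ?ltrBlDr ?ltrBrDr mulrC.
Qed.

Lemma wlength_preimage_affine c d A : 0 < c -> ocitv A ->
  (c%:E * wlength idfun (affine c d @^-1` A) = wlength idfun A)%E.
Proof.
move=> c0 [[x y] _ <-] /=; rewrite preimage_affine_itv// !wlength_itv/= !lte_fin.
rewrite ltr_pM2r ?invr_gt0// ltrD2r; case: ifP => _; last by rewrite mule0.
by rewrite -!EFinB -EFinM; congr EFin; field; rewrite gt_eqF.
Qed.

(** Pulling a cover of [A] by half-open intervals back along the affine map
    yields a cover of the preimage whose total length is [c] times smaller. *)
Lemma le_outer_preimage_affine c d A : 0 < c ->
  (c%:E * leb (affine c d @^-1` A) <= leb A)%E.
Proof.
move=> c0; apply: le_ereal_inf_tmp => _ [F [mF AF] <-].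
have -> : (\sum_(k <oo) wlength idfun (F k) =
    c%:E * \sum_(k <oo) wlength idfun (affine c d @^-1` F k))%E.
  have wlength_idfun_ge0 (B : set (ocitv_type R)) : (0 <= wlength idfun B)%E.
    exact: wlength_ge0.
  rewrite -nneseriesZl//.
  by apply: eq_eseriesr => k _; rewrite wlength_preimage_affine//; exact: mF.
rewrite lee_pmul2l// ?lte_fin//; apply: ereal_inf_lbound.
exists (fun k => affine c d @^-1` F k) => //; split.
  move=> k; have [[x y] _ <-] := mF k.
  by rewrite preimage_affine_itv//; exact: is_ocitv.
by move=> t /AF [k _ Fk]; exists k.
Qed.

(** The reverse inequality is the previous one for the inverse affine map. *)
Lemma outer_preimage_affine c d A : 0 < c ->
  (c%:E * leb (affine c d @^-1` A) = leb A)%E.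
Proof.
move=> c0; apply/eqP; rewrite eq_le le_outer_preimage_affine//=.
have cV0 : 0 < c^-1 by rewrite invr_gt0.
have := le_outer_preimage_affine (- (c^-1 * d)) (affine c d @^-1` A) cV0.
rewrite -comp_preimage.
have -> : affine c d \o affine c^-1 (- (c^-1 * d)) = id.
  by apply/funext => x; rewrite /= affineK// gt_eqF.
rewrite preimage_id -(@lee_pmul2l _ c%:E)// ?lte_fin//.
by rewrite muleA -EFinM divff ?gt_eqF// mul1e.
Qed.

(** The Caratheodory identity for the preimage of [A], tested on [X], is
    [c^-1] times the identity for [A], tested on the image of [X]. *)
Lemma measurable_affine c d : 0 < c ->
  measurable_fun [set: caraR] (affine c d : caraR -> caraR).
Proof.
move=> c0 _ A mA; rewrite setTI.
have caraA : forall X : set R, (leb X = leb (X `&` A) + leb (X `&` ~` A))%E.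
  exact: mA.
suff : forall X : set R, (leb X = leb (X `&` affine c d @^-1` A)
    + leb (X `&` ~` (affine c d @^-1` A)))%E by [].
move=> X; set psi := affine c^-1 (- (c^-1 * d)).
have psiK : affine c d \o psi = id.
  by apply/funext => x; rewrite /= affineK// gt_eqF.
have psiE (Y Z : set R) :
    psi @^-1` (Y `&` affine c d @^-1` Z) = psi @^-1` Y `&` Z.
  by rewrite preimage_setI -comp_preimage psiK preimage_id.
have cV0 : 0 < c^-1 by rewrite invr_gt0.
(* The image of [X] appears as its preimage under the inverse map [psi]. *)
have := congr1 (mule c^-1%:E) (caraA (psi @^-1` X)).
rewrite ge0_muleDr; try exact: mu_ext_ge0.
rewrite -(psiE X A) -(psiE X (~` A)).
by rewrite !(outer_preimage_affine _ _ cV0).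
Qed.

Lemma measurable_cara_itvcc x y : measurable (`[x, y]%classic : set caraR).
Proof. by apply: sub_caratheodory; exact: (@measurable_itv R `[x, y]). Qed.

Section ChangeOfVariable.
Variables a b : R.
Hypothesis ltab : a < b.

Let phi : caraR -> caraR := affine (b - a) a.

Let subab_gt0 : 0 < b - a. Proof. by rewrite subr_gt0. Qed.

Let mphi : measurable_fun [set: caraR] phi.
Proof. exact: measurable_affine. Qed.

Let preimage_phi : phi @^-1` `[a, b] = `[0, 1]%classic.
Proof. by rewrite preimage_affine_itv// subrr mul0r divff// gt_eqF. Qed.

Lemma ge0_integral_affine (F : caraR -> \bar R) :
  measurable_fun (`[a, b] : set caraR) F ->
  (forall x, `[a, b]%classic x -> (0 <= F x)%E) ->
  (\int[leb]_(x in `[a, b]) F x =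
   (b - a)%:E * \int[leb]_(t in `[0%R, 1%R]) F (phi t))%E.
Proof.
move=> mF F0; have mab := measurable_cara_itvcc a b.
(* The completed measure is [b - a] times its own image under [phi]. *)
rewrite (eq_measure_integral
  (mscale (NngNum (ltW subab_gt0)) (pushforward leb phi))); last first.
  by move=> B _ _; exact/esym/outer_preimage_affine.
rewrite ge0_integral_mscale// ge0_integral_pushforward//.
  by rewrite preimage_phi.
by move=> x /set_mem /F0.
Qed.

Lemma measurable_fun_affine (F : caraR -> \bar R) :
  measurable_fun (`[a, b] : set caraR) F ->
  measurable_fun (`[0, 1] : set caraR) (F \o phi).
Proof.
move=> mF; apply: (measurable_comp (measurable_cara_itvcc a b) _ mF).
  by rewrite -preimage_phi; exact: image_preimage_subset.
exact: measurable_funTS.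
Qed.

(** The change of variables applies to [`|u|], whose integral is nonnegative. *)
Lemma integrable_itv_affine (u : R -> R) :
  integrable_itv a b u -> integrable_itv 0 1 (u \o affine (b - a) a).
Proof.
move=> /integrableP[mu uoo]; apply/integrableP; split.
  exact: measurable_fun_affine mu.
move: uoo; rewrite ge0_integral_affine//; last exact: measurableT_comp.
suff lty_cancel (y : \bar R) : ((b - a)%:E * y < +oo -> y < +oo)%E.
  exact: lty_cancel.
by case: y => [r _||]; rewrite ?ltry ?ltNyr// gt0_muley// lte_fin.
Qed.

Lemma integral_itv_affine (u : R -> R) :
  nonneg_on `[a, b] u -> integrable_itv a b u ->
  integral_itv a b u = (b - a) * integral_itv 0 1 (u \o affine (b - a) a).
Proof.
move=> u0 iu; rewrite /integral_itv /Rintegral ge0_integral_affine//.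
- rewrite fineM//; apply: integrable_fin_num; first exact: measurable_cara_itvcc.
  exact: integrable_itv_affine.
- by move/integrableP : iu => [].
Qed.

End ChangeOfVariable.
End AffineInvariance.

Section Pointwise.
Variables (R : realType) (a b : R) (J : set R) (h : R -> R).
Hypothesis ltab : a < b.
Implicit Types f : R -> R.

Lemma symmetric_endpoints f : symmetric_about_midpoint a b f -> f b = f a.
Proof.
move=> f_sym; have aI : `[a, b]%classic a by rewrite /= in_itv/= lexx ltW.
by rewrite -(f_sym a aI); congr f; lra.
Qed.

(** The point [affine (b - a) a t] is the convex combination of [b] and [a] with
    weights [t] and [1 - t], and [f] takes the same value at both endpoints. *)
Lemma h_convex_le_endpoint f t :
  h_convex h `[a, b] f -> symmetric_about_midpoint a b f -> 0 <= t <= 1 ->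
  f (affine (b - a) a t) <= (h t + h (1 - t)) * f a.
Proof.
move=> [_ f_cvx] f_sym t01.
have aI : `[a, b]%classic a by rewrite /= in_itv/= lexx ltW.
have bI : `[a, b]%classic b by rewrite /= in_itv/= lexx ltW.
have := f_cvx b a t bI aI t01; rewrite (symmetric_endpoints f_sym) -mulrDl.
by have -> : t * b + (1 - t) * a = affine (b - a) a t by rewrite /affine; lra.
Qed.

Hypotheses (J01 : `[0, 1] `<=` J) (h_smul : supermultiplicative J h).

Lemma supermultiplicative_sqr_sum_le t : 0 <= t <= 1 ->
  (h t + h (1 - t)) ^+ 2 <=
  h (t ^+ 2) + 2 * h (t * (1 - t)) + h ((1 - t) ^+ 2).
Proof.
move=> /andP[t0 t1].
have hM x y : 0 <= x <= 1 -> 0 <= y <= 1 -> h x * h y <= h (x * y).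
  move=> x01 y01; have [/andP[x0 x1] /andP[y0 y1]] := (x01, y01).
  apply: h_smul; apply: J01; rewrite /= in_itv//=.
  by rewrite mulr_ge0//= mulr_ile1.
have t01 : 0 <= t <= 1 by rewrite t0.
have s01 : 0 <= 1 - t <= 1 by lra.
have := hM _ _ t01 t01; have := hM _ _ t01 s01; have := hM _ _ s01 s01.
rewrite -!expr2 sqrrD -mulr_natl; lra.
Qed.

End Pointwise.

Theorem theorem6 (R : realType) (a b : R) (J : set R) (h f g : R -> R)
  (ltab : a < b)
  (J01 : `[0, 1] `<=` J)
  (h_ge0 : nonneg_on J h)
  (h_smul : supermultiplicative J h)
  (f_SX : h_convex h `[a, b] f)
  (g_SX : h_convex h `[a, b] g)
  (f_sym : symmetric_about_midpoint a b f)
  (g_sym : symmetric_about_midpoint a b g)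
  (int_fg : integrable_itv a b (fun x => f x * g x))
  (int_h1 : integrable_itv 0 1 (fun t => h (t ^+ 2)))
  (int_h2 : integrable_itv 0 1 (fun t => h (t * (1 - t))))
  (int_h3 : integrable_itv 0 1 (fun t => h ((1 - t) ^+ 2))) :
  1 / (b - a) * integral_itv a b (fun x => f x * g x) <=
  (M_sum f g a b + N_sum f g a b) / 4 *
    (integral_itv 0 1 (fun t => h (t ^+ 2)) +
     2 * integral_itv 0 1 (fun t => h (t * (1 - t))) +
     integral_itv 0 1 (fun t => h ((1 - t) ^+ 2))).
Proof.
have aI : `[a, b]%classic a by rewrite /= in_itv/= lexx ltW.
have fa0 : 0 <= f a by exact: f_SX.1.
have ga0 : 0 <= g a by exact: g_SX.1.
have fg0 : nonneg_on `[a, b] (fun x => f x * g x).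
  by move=> x xI; rewrite mulr_ge0//; [exact: f_SX.1|exact: g_SX.1].
have -> : (M_sum f g a b + N_sum f g a b) / 4 = f a * g a.
  rewrite /M_sum /N_sum (symmetric_endpoints ltab f_sym).
  by rewrite (symmetric_endpoints ltab g_sym); field.
rewrite (integral_itv_affine ltab fg0 int_fg) mulrA div1r.
rewrite mulVf ?mul1r; last first.
  by rewrite subr_eq0 gt_eqF.
have mI := @measurable_cara_itvcc R 0 1.
have int_2h2 : integrable_itv 0 1 (fun t => 2 * h (t * (1 - t))).
  exact: (integrableZl mI 2 int_h2).
have int_h12 :
    integrable_itv 0 1 (fun t => h (t ^+ 2) + 2 * h (t * (1 - t))).
  exact: (integrableD mI int_h1 int_2h2).
have int_h123 : integrable_itv 0 1
    (fun t => h (t ^+ 2) + 2 * h (t * (1 - t)) + h ((1 - t) ^+ 2)).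
  exact: (integrableD mI int_h12 int_h3).
rewrite /integral_itv -(RintegralZl 2 mI int_h2) -(RintegralD mI int_h1 int_2h2).
rewrite -(RintegralD mI int_h12 int_h3) -(RintegralZl _ mI int_h123).
apply: le_Rintegral => //.
- exact: (integrable_itv_affine ltab int_fg).
- exact: (integrableZl mI (f a * g a) int_h123).
move=> t; rewrite /= in_itv/= => t01.
have phi_t : `[a, b]%classic (affine (b - a) a t).
  by rewrite /= in_itv /= /affine; nra.
have f_le := h_convex_le_endpoint ltab f_SX f_sym t01.
have g_le := h_convex_le_endpoint ltab g_SX g_sym t01.
apply: le_trans (ler_pM (f_SX.1 _ phi_t) (g_SX.1 _ phi_t) f_le g_le) _.
rewrite mulrACA mulrC -expr2 ler_wpM2l ?mulr_ge0//.
exact: (supermultiplicative_sqr_sum_le J01 h_smul t01).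
Qed.
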